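(* For $n\ge 1$, \begin{align*} A_n(p,q,t)&=\sum_{k=0}^{\lfloor{(n-1)/2\rfloor}}\gamma_{n,k}(p,q)\,t^{k}(1+t)^{n-1-2k}\\ &=\sum_{k=0}^{\lfloor{(n-1)/2\rfloor}}(p+q)^k\,\mathrm{d}_{n, k}(p,q)\,t^{k}(1+t)^{n-1-2k}. \end{align*}
   Context: For a permutation $\sigma=\sigma_1\ldots\sigma_n$ of $[n]$: $\operatorname{des}\sigma$ is the number of $i<n$ with $\sigma_i>\sigma_{i+1}$; $\operatorname{les}\sigma$ is the number of pairs $(i,j)$ with $2\le i<j\le n$ and $\sigma_{i-1}>\sigma_j>\sigma_i$; $\operatorname{res}\sigma$ is the number of pairs $(i,j)$ with $1\le i<j\le n-1$ and $\sigma_{j+1}>\sigma_i>\sigma_j$. With the convention $\sigma_0=\sigma_{n+1}=0$, an entry $\sigma_i$ is a valley if $\sigma_{i-1}>\sigma_i<\sigma_{i+1}$ and a double descent if $\sigma_{i-1}>\sigma_i>\sigma_{i+1}$. Let $\mathcal{G}_{n,k}$ be the set of permutations of $[n]$ with exactly $k$ valleys and no double descents. For $\sigma$ a permutation of $[n]$, $\sigma_{[k]}$ denotes the subword of $\sigma$ formed by the letters $1,\dots,k$ in the order they appear; $\sigma$ is an André permutation if, for every $1\le k\le n$, $\sigma_{[k]}$ has no double descents and ends with an ascent. Let $\mathfrak{D}_{n,k}$ be the set of André permutations of $[n]$ with $k$ descents. Define $A_n(p,q,t)=\sum_{\sigma\in\mathfrak{S}_n}p^{\operatorname{res}\sigma}q^{\operatorname{les}\sigma}t^{\operatorname{des}\sigma}$,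 $\gamma_{n,k}(p,q)=\sum_{\sigma\in\mathcal{G}_{n,k}}p^{\operatorname{res}\sigma}q^{\operatorname{les}\sigma}$, $\mathrm{d}_{n,k}(p,q)=\sum_{\sigma\in\mathfrak{D}_{n,k}}p^{\operatorname{res}\sigma}q^{\operatorname{les}\sigma-k}$. *)

(* Defs.v *)
From HB Require Import structures.
From mathcomp Require Export all_boot all_order fingroup perm all_algebra.

Set Implicit Arguments.
Unset Strict Implicit.
Unset Printing Implicit Defensive.

Import GRing.Theory.

(* Permutations of [n] are 'S_n, acting on {0, ..., n-1}; [word] shifts the
   values back to {1, ..., n}, so that 0 is free for the boundary convention. *)
Definition word (n : nat) (s : 'S_n) : seq nat :=
  [seq (s i).+1 | i <- enum 'I_n].

(* w_i with 1-based positions and w_0 = w_(size w + 1) = 0: index 0 hits the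
   prepended 0 and index size w + 1 the default value of nth. *)
Definition letter (w : seq nat) (i : nat) : nat := nth 0 (0 :: w) i.

Definition des (w : seq nat) : nat :=
  \sum_(1 <= i < size w) (letter w i > letter w i.+1).

Definition les (w : seq nat) : nat :=
  \sum_(2 <= i < (size w).+1) \sum_(i.+1 <= j < (size w).+1)
    ((letter w i.-1 > letter w j) && (letter w j > letter w i)).

Definition res (w : seq nat) : nat :=
  \sum_(1 <= j < size w) \sum_(1 <= i < j)
    ((letter w j.+1 > letter w i) && (letter w i > letter w j)).

Definition is_valley (w : seq nat) (i : nat) : bool :=
  (letter w i.-1 > letter w i) && (letter w i < letter w i.+1).

Definition is_double_descent (w : seq nat) (i : nat) : bool :=
  (letter w i.-1 > letter w i) && (letter w i > letter w i.+1).

Definition valleys (w : seq nat) : nat :=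
  \sum_(1 <= i < (size w).+1) is_valley w i.

Definition no_double_descent (w : seq nat) : bool :=
  all (fun i => ~~ is_double_descent w i) (iota 1 (size w)).

(* A one-letter word w_1 > 0 ends with an ascent, since w_0 = 0. *)
Definition ends_with_ascent (w : seq nat) : bool :=
  letter w (size w).-1 < letter w (size w).

Definition subword (w : seq nat) (k : nat) : seq nat :=
  [seq a <- w | 1 <= a <= k].

Definition is_andre (w : seq nat) : bool :=
  all (fun k => no_double_descent (subword w k) && ends_with_ascent (subword w k))
    (iota 1 (size w)).

Definition Gset (n k : nat) : {set 'S_n} :=
  [set s : 'S_n | (valleys (word s) == k) && no_double_descent (word s)].

Definition Dset (n k : nat) : {set 'S_n} :=
  [set s : 'S_n | is_andre (word s) && (des (word s) == k)].

Local Open Scope ring_scope.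

(* The polynomials are given by their values at arbitrary p, q, t in an
   arbitrary commutative ring; indeterminates over int are one instance. *)

Definition Apoly (R : comNzRingType) (n : nat) (p q t : R) : R :=
  \sum_(s : 'S_n) p ^+ res (word s) * q ^+ les (word s) * t ^+ des (word s).

Definition gamma (R : comNzRingType) (n k : nat) (p q : R) : R :=
  \sum_(s in Gset n k) p ^+ res (word s) * q ^+ les (word s).

(* The subtraction in the exponent never truncates: if w_(i-1) > w_i is a
   descent of an Andre permutation w, then in the subword of letters
   <= w_(i-1) the letter w_i is followed by a larger one, which forms with
   this descent a pair counted by les; hence les w >= des w. *)
Definition dpoly (R : comNzRingType) (n k : nat) (p q : R) : R :=
  \sum_(s in Dset n k) p ^+ res (word s) * q ^+ (les (word s) - k).

(* Main.v *)
From mathcomp Require Import zify ring.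
Require Import Defs.

(** A permutation is built by inserting 1, 2, ..., n in this order.  Before the
    letter c is inserted, the smaller letters form blocks separated by m gaps,
    the maximal runs of letters still to come.  Putting c into the g-th gap adds
    g - 1 to [les] and m - g to [res]; according to whether c leaves a gap on its
    left and on its right, it becomes a valley (m grows by 1), a double descent
    or a double ascent (m is kept), or a peak (m drops by 1).  Give valleys,
    double descents and double ascents the weights x, d and e: the weighted sum
    over all permutations counts Motzkin paths whose up, level and down steps
    from height m weigh x [m], (d + e) [m] and [m].  It depends on d + e only, so
    (d, e) = (t, 1), which gives A_n, may be replaced by (0, 1 + t), which gives
    the expansion in gamma_{n,k}.

    For Andre permutations the left gap created by a valley is locked until its
    right gap, the next one, receives a letter.  If these are the gaps i and
    i + 1, the weight of the latter, freed of one factor q and multiplied by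
    p + q, is q^(i-1) p^(m-i-1) (p + q), which is the sum of the weights of both
    gaps; so the locks cost exactly one factor p + q per valley. *)

Set Implicit Arguments.
Unset Strict Implicit.
Unset Printing Implicit Defensive.

Import GRing.Theory.

Lemma iota_rcons m n : iota m n.+1 = rcons (iota m n) (m + n).
Proof. by rewrite -addn1 iotaD cats1. Qed.

Lemma big_nat_fibers (R : Type) (idx : R) (op : Monoid.com_law idx) (T : finType)
    (P : pred T) (stat : T -> nat) (F : nat -> T -> R) m :
  (forall s, P s -> stat s < m) ->
  \big[op/idx]_(0 <= k < m) \big[op/idx]_(s | P s && (stat s == k)) F k s =
  \big[op/idx]_(s | P s) F (stat s) s.
Proof.
move=> stat_lt; rewrite (exchange_big_dep P) /= => [|k s _ /andP[] //].
apply: eq_bigr => s Ps; under eq_bigl => k do rewrite Ps eq_sym.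
by rewrite big_nat1_eq /= stat_lt.
Qed.

Section SplitsAt.

Variables (T : eqType) (x : T).
Implicit Types s u v : seq T.

Fixpoint splits_at s : seq (seq T * seq T) :=
  if s is y :: s' then
    (if y == x then [:: ([::], s')] else [::])
    ++ [seq (y :: uv.1, uv.2) | uv <- splits_at s']
  else [::].

Lemma mem_splits_at s u v : ((u, v) \in splits_at s) = (s == u ++ x :: v).
Proof.
elim: s u => [|y s IHs] [|z u] //=; rewrite mem_cat eqseq_cons.
  rewrite [X in _ || X](_ : _ = false) ?orbF; last by apply/mapP => -[].
  by case: eqP => //= _; rewrite inE xpair_eqE eqxx /= eq_sym.
rewrite [X in X || _](_ : _ = false); last by case: eqP => // _; rewrite inE.
rewrite -IHs /=; apply/mapP/andP => [[[u' v'] uv_in [-> -> ->]]|[/eqP-> uv_in]].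
  by rewrite eqxx.
by exists (u, v).
Qed.

Lemma splits_at_uniq s : uniq (splits_at s).
Proof.
elim: s => [|y s IHs] //=.
rewrite cat_uniq map_inj_uniq ?IHs ?andbT => [|[u v] [u' v'] [-> ->] //].
apply/andP; split; first by case: eqP.
by apply/hasPn => _ /mapP[uv _ ->]; case: eqP.
Qed.

Lemma flatten_splits_at_uniq (r : seq (seq T)) :
  uniq r -> uniq (flatten [seq splits_at s | s <- r]).
Proof.
elim: r => [|s r IHr] //= /andP[s_r uniq_r].
rewrite cat_uniq splits_at_uniq IHr // andbT.
apply/hasPn => -[u v] /flatten_mapP[s' s'_r]; rewrite !mem_splits_at => /eqP s'E.
by apply: contraNN s_r => /eqP->; rewrite -s'E.
Qed.

End SplitsAt.

(** * Valleys, double ascents and double descents *)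

(* [F] is told whether a letter is smaller than its left and right neighbours;
   [x] and [e] are the letters before and after [w]. *)
Fixpoint slope_count (F : bool -> bool -> bool) (x : nat) (w : seq nat) (e : nat) :
    nat :=
  if w is c :: w' then F (c < x) (c < head e w') + slope_count F c w' e else 0.

Definition slope_stat (F : bool -> bool -> bool) (w : seq nat) : nat :=
  slope_count F 0 w 0.

Definition double_descent (a b : bool) : bool := a && ~~ b.
Definition double_ascent (a b : bool) : bool := ~~ a && b.

Arguments double_descent a b /.
Arguments double_ascent a b /.

Definition double_descents : seq nat -> nat := slope_stat double_descent.
Definition double_ascents : seq nat -> nat := slope_stat double_ascent.

Lemma slope_count_cat F x u w e :
  slope_count F x (u ++ w) e =
  slope_count F x u (head e w) + slope_count F (last x u) w e.
Proof. by elim: u x => [|c u IHu] x //=; rewrite IHu addnA; case: (u). Qed.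

Lemma eq_slope_count_start F x x' w e :
  (head e w < x) = (head e w < x') -> slope_count F x w e = slope_count F x' w e.
Proof. by case: w => //= c w ->. Qed.

Lemma eq_slope_count_end F x w e e' :
  (last x w < e) = (last x w < e') -> slope_count F x w e = slope_count F x w e'.
Proof.
elim: w x => [|c w IHw] x //= eq_e; rewrite (IHw c) //.
by case: w eq_e {IHw} => //= ->.
Qed.

Lemma slope_count_nthE (F : bool -> bool -> bool) x w :
  \sum_(0 <= i < size w)
     F (nth 0 w i < nth 0 (x :: w) i) (nth 0 w i < nth 0 w i.+1) =
  slope_count F x w 0.
Proof.
elim: w x => [|c w IHw] x; first by rewrite big_nil.
by rewrite big_nat_recl //= IHw nth0.
Qed.

Lemma slope_statE (F : bool -> bool -> bool) w :
  \sum_(1 <= i < (size w).+1)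
     F (letter w i < letter w i.-1) (letter w i < letter w i.+1) =
  slope_stat F w.
Proof. by rewrite big_add1 slope_count_nthE. Qed.

Lemma valleysE w : valleys w = slope_stat andb w.
Proof. by rewrite -slope_statE. Qed.

Lemma desE w : des w = valleys w + double_descents w.
Proof.
have -> : des w = slope_stat (fun a _ => a) w.
  rewrite -slope_statE /des; case: w => [|c w]; first by rewrite !big_geq.
  by rewrite [RHS]big_ltn // [in RHS]big_add1.
suff count_descents x : slope_count (fun a _ => a) x w 0 =
    slope_count andb x w 0 + slope_count double_descent x w 0.
  by rewrite valleysE; apply: count_descents.
elim: w x => //= c w IHw x; rewrite IHw addnACA; congr addn.
by case: (c < x); case: (c < head 0 w).
Qed.

Lemma letter_rcons w c i : i <= size w -> letter (rcons w c) i = letter w i.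
Proof. by move=> le_i; rewrite /letter -rcons_cons nth_rcons /= ltnS le_i. Qed.

Lemma letter_rcons_last w c : letter (rcons w c) (size w).+1 = c.
Proof. by rewrite /letter /= nth_rcons ltnn eqxx. Qed.

Lemma letter_size w : letter w (size w) = last 0 w.
Proof. exact: (nth_last 0 (0 :: w)). Qed.

Lemma letter_sizeS w : letter w (size w).+1 = 0.
Proof. by rewrite /letter /= nth_default. Qed.

Lemma letter_neqS w i :
  uniq (0 :: w) -> i <= size w -> 0 < size w -> letter w i != letter w i.+1.
Proof.
move=> uniq_0w; rewrite leq_eqVlt => /predU1P[-> w_gt0|lt_i _].
  rewrite letter_sizeS letter_size; case/lastP: w uniq_0w w_gt0 => // w c.
  by rewrite last_rcons /= mem_rcons inE negb_or eq_sym => /andP[/andP[]].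
by rewrite /letter nth_uniq ?(ltn_eqF (leqnn _)) // ltnW.
Qed.

Lemma no_double_descentE w :
  uniq (0 :: w) -> no_double_descent w = (double_descents w == 0).
Proof.
move=> uniq_0w; rewrite -[double_descents w]slope_statE sum_nat_seq_eq0.
rewrite /index_iota subn1 /=; apply: eq_in_all => i; rewrite mem_iota => i_bounds.
rewrite eqb0 -leqNgt /is_double_descent [letter w i.+1 < _]ltn_neqAle eq_sym.
by rewrite letter_neqS //; lia.
Qed.

Lemma no_double_descent_ends_with_ascent w :
  uniq (0 :: w) -> 0 < size w -> no_double_descent w -> ends_with_ascent w.
Proof.
move=> uniq_0w w_gt0 /allP/(_ (size w)); rewrite mem_iota w_gt0 ltnSn => /(_ isT).
rewrite /is_double_descent /ends_with_ascent letter_sizeS.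
have := @letter_neqS w (size w).-1 uniq_0w (leq_pred _) w_gt0.
have := @letter_neqS w (size w) uniq_0w (leqnn _) w_gt0.
rewrite letter_sizeS prednK //; lia.
Qed.

Lemma ascent_after_descent u c d v :
  double_descents (u ++ [:: c, d & v]) = 0 -> d < c -> d < head 0 v.
Proof.
rewrite /double_descents /slope_stat slope_count_cat /= => no_dd lt_d.
by move: no_dd; rewrite lt_d; case: (d < _) => //=; lia.
Qed.

Lemma leq_double_descents_end x w e e' :
  last x w < e' ->
  slope_count double_descent x w e' <= slope_count double_descent x w e.
Proof.
elim: w x => //= c w IHw x lt_e'; apply: leq_add; last exact: IHw.
by case: w lt_e' {IHw} => //= ->; rewrite andbF.
Qed.

Definition starts_with_descent (w : seq nat) : bool :=
  if w is c :: w' then head 0 w' <= c else false.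

Lemma double_descents_insert_max m u v :
  last 0 u < m -> head 0 v < m -> double_descents (u ++ v) = 0 ->
  (double_descents (u ++ m :: v) == 0) = ~~ starts_with_descent v.
Proof.
move=> lt_u lt_v; rewrite /double_descents /slope_stat !slope_count_cat /=.
move/eqP; rewrite addn_eq0 => /andP[/eqP count_u count_v].
have := leq_double_descents_end (head 0 v) lt_u; rewrite count_u leqn0 => /eqP->.
have -> : (m < last 0 u) = false by lia.
case: v lt_v count_v {count_u} => [|c v] //= lt_c.
by rewrite addn_eq0 => /andP[_ /eqP->]; rewrite addn0 add0n eqb0 lt_c -leqNgt.
Qed.

(** * The statistics [les] and [res] *)

Definition descents_across (c x : nat) (w : seq nat) : nat :=
  count id (pairmap (fun a b => b < c < a) x w).

Lemma descents_across_cat c x u w :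
  descents_across c x (u ++ w) =
  descents_across c x u + descents_across c (last x u) w.
Proof. by rewrite /descents_across pairmap_cat count_cat. Qed.

Lemma descents_acrossE c w :
  \sum_(2 <= i < (size w).+1) (letter w i < c < letter w i.-1) =
  descents_across c 0 w.
Proof.
rewrite /descents_across -sumn_count sumnE big_map (big_nth false) size_pairmap.
case: w => [|d w]; first by rewrite !big_geq.
rewrite [RHS]big_ltn //= andbF add0n !big_add1 /=.
by apply: eq_big_nat => i lt_i; rewrite (nth_pairmap 0).
Qed.

Lemma descents_across_ge c x w :
  all (leq^~ c) (x :: w) -> descents_across c x w = 0.
Proof.
elim: w x => //= d w IHw x /andP[le_x all_w].
by rewrite /descents_across /= [c < x]ltnNge le_x andbF add0n; apply: IHw.
Qed.

Lemma les_rcons w c : les (rcons w c) = les w + descents_across c 0 w.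
Proof.
rewrite -descents_acrossE /les size_rcons; case: (posnP (size w)) => [->|w_gt0].
  by rewrite !big_geq.
rewrite big_nat_recr // [X in _ + X = _]big_geq // addn0 -big_split /=.
apply: eq_big_nat => i lt_i; rewrite big_nat_recr /=; last by lia.
congr addn; last by rewrite letter_rcons_last !letter_rcons 1?andbC //; lia.
by apply: eq_big_nat => j lt_j; rewrite !letter_rcons //; lia.
Qed.

Lemma les_cat_congr w w' v :
  {in v, forall c u,
     descents_across c 0 (w ++ u) = descents_across c 0 (w' ++ u)} ->
  les (w ++ v) + les w' = les (w' ++ v) + les w.
Proof.
elim/last_ind: v => [|v c IHv] eq_across; first by rewrite !cats0 addnC.
rewrite -!rcons_cat !les_rcons eq_across ?mem_rcons ?mem_head // addnAC.
rewrite IHv; first by rewrite addnAC.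
by move=> d d_v u; rewrite eq_across // mem_rcons inE d_v orbT.
Qed.

Lemma letter_rev w i :
  0 < i <= size w -> letter (rev w) i = letter w ((size w).+1 - i).
Proof.
case: i => // i lt_i; rewrite /letter /= nth_rev // subSS.
by rewrite -[in RHS](prednK (_ : 0 < size w - i)) ?subn_gt0 //= subnS.
Qed.

Lemma res_rev w : res w = les (rev w).
Proof.
rewrite /les size_rev big_nat_rev /= big_add1 /res /=.
apply: eq_big_nat => k lt_k; rewrite [RHS]big_nat_rev /=.
have -> : (2 + (size w).+1 - k.+2).+1 = 1 + ((size w).+1 - k) by lia.
rewrite big_addn subKn; last by lia.
apply: eq_big_nat => i lt_i; rewrite !letter_rev; try lia.
by congr ((letter w _ < letter w _) && (letter w _ < letter w _)); lia.
Qed.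

(** * Words with gaps *)

(* Andre words in the presence of a gap letter, which exceeds [y] and hence
   disappears from the subwords. *)
Definition andre (y : nat) (w : seq nat) : bool :=
  (double_descents w == 0) &&
  all (fun k => double_descents (subword w k) == 0) (iota 0 y.+1).

Section GapWords.

(* A gap is encoded by a letter larger than all others, so that [les], [res] and
   [valleys] keep their meaning on unfinished words. *)
Variable gap : nat.
Implicit Types (y c : nat) (w u v : seq nat) (a b : bool).

Definition gaps w : nat := count_mem gap w.

Definition ungap w : seq nat := [seq c <- w | c != gap].

Definition not_both_gaps c d : bool := (c != gap) || (d != gap).

Definition letter_or_gap y c : bool := (0 < c <= y) || (c == gap).

Definition gapword y w : bool :=
  [&& y < gap, w != [::], perm_eq (ungap w) (iota 1 y) & sorted not_both_gaps w].

Lemma gapword_gap_gt0 y w : gapword y w -> 0 < gap.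
Proof. by case/and4P => /(leq_trans _) ->. Qed.

Lemma gapword_lt_gap y w : gapword y w -> y < gap.
Proof. by case/and4P. Qed.

Lemma gapword_all y w : gapword y w -> all (letter_or_gap y) w.
Proof.
case/and4P => _ _ perm_w _; apply/allP => c c_w; rewrite /letter_or_gap.
have := perm_mem perm_w c; rewrite mem_filter c_w andbT mem_iota add1n ltnS => <-.
by rewrite orNb.
Qed.

Lemma gapword0 w : gapword 0 w = (0 < gap) && (w == [:: gap]).
Proof.
apply/and4P/andP => [[gap_gt0 w_neq0 /perm_size/eqP]|[gap_gt0 /eqP->]]; last first.
  by rewrite gap_gt0 /ungap /= eqxx.
rewrite size_filter -leqn0 leqNgt -has_count => /hasPn no_letter; split=> //.
have {no_letter} all_gap c : c \in w -> c = gap.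
  by move/no_letter; rewrite negbK => /eqP.
case: w w_neq0 all_gap p => // c [|d w'] _ all_gap.
  by rewrite (all_gap c) ?mem_head.
rewrite (all_gap c) ?mem_head // (all_gap d) ?inE ?eqxx ?orbT //.
by rewrite /= /not_both_gaps eqxx.
Qed.

Lemma sorted_not_both_gaps_rev w :
  sorted not_both_gaps (rev w) = sorted not_both_gaps w.
Proof.
by rewrite rev_sorted; apply: eq_sorted => c d; rewrite /not_both_gaps orbC.
Qed.

Lemma gapword_rev y w : gapword y (rev w) = gapword y w.
Proof.
rewrite /gapword -!size_eq0 size_rev /ungap filter_rev perm_rev.
by rewrite sorted_not_both_gaps_rev.
Qed.

Lemma sorted_not_both_gaps_cat u v : 0 < gap ->
  sorted not_both_gaps (u ++ v) =
  [&& sorted not_both_gaps u, sorted not_both_gaps v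
    & not_both_gaps (last 0 u) (head 0 v)].
Proof.
move=> gap_gt0; have gap_neq0 : 0 != gap by rewrite ltn_eqF.
case: u => [|c u] /=; first by rewrite /not_both_gaps gap_neq0 andbT.
rewrite cat_path; congr andb; case: v => [|d v] /=; last by rewrite andbC.
by rewrite /not_both_gaps gap_neq0 orbT.
Qed.

Lemma gapword_catE y u v :
  gapword y (u ++ gap :: v) =
  [&& y < gap, perm_eq (ungap (u ++ v)) (iota 1 y), sorted not_both_gaps u,
      sorted not_both_gaps v, last 0 u != gap & head 0 v != gap].
Proof.
rewrite /gapword; case: ltnP => //= lt_y.
have gap_gt0 : 0 < gap by exact: leq_ltn_trans lt_y.
have -> : ungap (u ++ gap :: v) = ungap (u ++ v).
  by rewrite /ungap !filter_cat /= eqxx.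
rewrite sorted_not_both_gaps_cat // -cat1s (sorted_not_both_gaps_cat [:: gap]) //=.
rewrite /not_both_gaps eqxx /= orbF -[u ++ _ == _]size_eq0 size_cat addnS /=.
by rewrite -!andbA; do !bool_congr.
Qed.

Lemma gapword_cat_all y u v :
  gapword y (u ++ gap :: v) -> all (letter_or_gap y) u /\ all (letter_or_gap y) v.
Proof. by move/gapword_all; rewrite all_cat /= => /and3P[]. Qed.

Lemma gapword_cat_ends y u v :
  gapword y (u ++ gap :: v) ->
  [/\ last 0 u != gap, head 0 v != gap, last 0 u <= y & head 0 v <= y].
Proof.
move=> gap_uv; have [all_u all_v] := gapword_cat_all gap_uv.
move: gap_uv; rewrite gapword_catE => /and5P[_ _ _ _ /andP[u_gap v_gap]].
split=> //.
  have := mem_last 0 u; rewrite inE => /predU1P[-> //|/(allP all_u)].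
  by rewrite /letter_or_gap (negbTE u_gap) orbF => /andP[].
case: (v) all_v v_gap => //= c v' /andP[+ _] c_gap.
by rewrite /letter_or_gap (negbTE c_gap) orbF => /andP[].
Qed.

Lemma head_ungap w : head 0 w != gap -> head 0 (ungap w) = head 0 w.
Proof. by case: w => //= c w ->. Qed.

Lemma last_ungap w : last 0 w != gap -> last 0 (ungap w) = last 0 w.
Proof.
case/lastP: w => // w c; rewrite last_rcons /ungap filter_rcons => ->.
by rewrite last_rcons.
Qed.

Lemma subword_ungap k y w :
  all (letter_or_gap y) w -> y <= k < gap -> subword w k = ungap w.
Proof.
move=> /allP all_w le_k; apply: eq_in_filter => c /all_w.
by rewrite /letter_or_gap; lia.
Qed.

Lemma andre_ungap y w : gapword y w -> andre y w -> double_descents (ungap w) = 0.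
Proof.
move=> gap_w /andP[_ /allP/(_ y)]; rewrite mem_iota leq0n ltnSn => /(_ isT)/eqP.
by rewrite (subword_ungap (gapword_all gap_w)) // leqnn (gapword_lt_gap gap_w).
Qed.

(** * Insertion of the next letter *)

Definition fill c (uv : seq nat * seq nat) (ab : bool * bool) : seq nat :=
  uv.1 ++ nseq ab.1 gap ++ c :: nseq ab.2 gap ++ uv.2.

Definition unfill c w : (seq nat * seq nat) * (bool * bool) :=
  let l := take (index c w) w in
  let r := drop (index c w).+1 w in
  let a := last 0 l == gap in
  let b := head 0 r == gap in
  ((take (size l - a) l, drop b r), (a, b)).

Lemma fillK c u v a b :
  c != gap -> c \notin u -> last 0 u != gap -> head 0 v != gap ->
  unfill c (fill c (u, v) (a, b)) = ((u, v), (a, b)).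
Proof.
move=> c_gap c_u u_gap v_gap; rewrite /unfill /fill /= catA.
have -> : index c ((u ++ nseq a gap) ++ c :: nseq b gap ++ v) =
    size (u ++ nseq a gap).
  rewrite index_cat mem_cat (negbTE c_u) mem_nseq (negbTE c_gap) andbF /=.
  by rewrite eqxx addn0.
rewrite take_size_cat // -cat_rcons drop_size_cat ?size_rcons //.
have -> : (last 0 (u ++ nseq a gap) == gap) = a.
  by rewrite last_cat; case: a => /=; rewrite ?eqxx ?(negbTE u_gap).
have -> : (head 0 (nseq b gap ++ v) == gap) = b.
  by case: b => /=; rewrite ?eqxx ?(negbTE v_gap).
rewrite size_cat size_nseq addnK take_size_cat //.
by rewrite -[b in drop b](size_nseq b gap) drop_size_cat.
Qed.

Lemma ungap_fill c u v a b :
  c != gap -> ungap (fill c (u, v) (a, b)) = ungap u ++ c :: ungap v.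
Proof.
move=> c_gap; rewrite /ungap /fill /= !filter_cat /= c_gap filter_cat.
by rewrite !filter_nseq eqxx.
Qed.

Lemma gapword_fill y u v a b :
  y.+1 < gap -> last 0 u != gap -> head 0 v != gap ->
  gapword y.+1 (fill y.+1 (u, v) (a, b)) = gapword y (u ++ gap :: v).
Proof.
move=> lt_y u_gap v_gap; rewrite gapword_catE u_gap v_gap !andbT (ltnW lt_y) /=.
have gap_gt0 : 0 < gap by exact: leq_ltn_trans lt_y.
have y_gap : y.+1 != gap by rewrite ltn_eqF.
have nonempty : fill y.+1 (u, v) (a, b) != [::] by case: (u) (a) => [|? ?] [].
rewrite /gapword lt_y nonempty ungap_fill // iota_rcons add1n.
rewrite perm_sym perm_rcons perm_sym -cat1s perm_catCA perm_cons /ungap filter_cat.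
congr andb; rewrite /fill /= !sorted_not_both_gaps_cat // -cat1s.
rewrite !sorted_not_both_gaps_cat //; case: (a) (b) => [] [] /=.
all: by rewrite /not_both_gaps ?eqxx ?u_gap ?v_gap ?y_gap ?orbT ?andbT.
Qed.

Lemma strip_leading_gap w :
  0 < gap -> sorted not_both_gaps w ->
  exists v b, w = nseq b gap ++ v /\ head 0 v != gap.
Proof.
move=> gap_gt0; case: w => [_|c v].
  by exists [::], false; rewrite /= ltn_eqF.
rewrite -cat1s sorted_not_both_gaps_cat // => /and3P[_ _].
case: (eqVneq c gap) => [->|c_gap _].
  by rewrite /not_both_gaps eqxx; exists v, true.
by exists (c :: v), false.
Qed.

Lemma strip_trailing_gap w :
  0 < gap -> sorted not_both_gaps w ->
  exists u a, w = u ++ nseq a gap /\ last 0 u != gap.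
Proof.
rewrite -sorted_not_both_gaps_rev => gap_gt0 /(strip_leading_gap gap_gt0).
case=> [v [b [w_eq v_gap]]]; exists (rev v), b; split.
  by rewrite -[w]revK w_eq rev_cat rev_nseq.
by case: v v_gap {w_eq} => //= c v; rewrite rev_cons last_rcons.
Qed.

Lemma gapword_exists_fill y w :
  gapword y.+1 w ->
  exists u v a b, w = fill y.+1 (u, v) (a, b) /\ gapword y (u ++ gap :: v).
Proof.
move=> gap_w; have lt_y := gapword_lt_gap gap_w.
have gap_gt0 := gapword_gap_gt0 gap_w.
have y_w : y.+1 \in w.
  have /and4P[_ _ /perm_mem/(_ y.+1)] := gap_w.
  by rewrite mem_filter mem_iota add1n !ltnS leqnn => /andP[].
case/splitPr: y_w gap_w => l r gap_w; have /and4P[_ _ _] := gap_w.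
rewrite sorted_not_both_gaps_cat //= => /and3P[sorted_l /path_sorted sorted_r _].
have [u [a [l_eq u_gap]]] := strip_trailing_gap gap_gt0 sorted_l.
have [v [b [r_eq v_gap]]] := strip_leading_gap gap_gt0 sorted_r.
have w_eq : l ++ y.+1 :: r = fill y.+1 (u, v) (a, b).
  by rewrite l_eq r_eq /fill -catA.
by exists u, v, a, b; rewrite -(@gapword_fill _ _ _ a b) // -w_eq.
Qed.

Lemma gapword_ind (P : nat -> seq nat -> Prop) :
  P 0 [:: gap] ->
  (forall y u v a b, y.+1 < gap -> gapword y (u ++ gap :: v) ->
     P y (u ++ gap :: v) -> P y.+1 (fill y.+1 (u, v) (a, b))) ->
  forall y w, gapword y w -> P y w.
Proof.
move=> P0 P_fill; elim=> [w|y IHy w gap_w].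
  by rewrite gapword0 => /andP[_ /eqP->].
have lt_y := gapword_lt_gap gap_w.
have [u [v [a [b [-> gap_uv]]]]] := gapword_exists_fill gap_w.
exact: P_fill (IHy _ gap_uv).
Qed.

Fixpoint gapwords y : seq (seq nat) :=
  if y is y'.+1 then
    [seq fill y uv ab |
       uv <- flatten [seq splits_at gap w | w <- gapwords y'],
       ab <- [:: (true, true); (true, false); (false, true); (false, false)]]
  else [:: [:: gap]].

Lemma mem_gapwords y w : y < gap -> (w \in gapwords y) = gapword y w.
Proof.
elim: y w => [|y IHy] w lt_y; first by rewrite gapword0 lt_y inE.
have {IHy} IHy w' : (w' \in gapwords y) = gapword y w' := IHy w' (ltnW lt_y).
apply/allpairsP/idP => [[[[u v] [a b]]]|gap_w] /=.
  case=> /flatten_mapP[w' + uv_in] _ ->; rewrite IHy.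
  move: uv_in; rewrite mem_splits_at => /eqP-> gap_uv.
  by have [u_gap v_gap _ _] := gapword_cat_ends gap_uv; rewrite gapword_fill.
have [u [v [a [b [-> gap_uv]]]]] := gapword_exists_fill gap_w.
exists ((u, v), (a, b)); split=> //=; last by case: (a) (b) => [] [].
by apply/flatten_mapP; exists (u ++ gap :: v); rewrite ?IHy ?mem_splits_at.
Qed.

Lemma gapwords_uniq y : y < gap -> uniq (gapwords y).
Proof.
elim: y => // y IHy lt_y; apply: allpairs_uniq => //.
  by apply/flatten_splits_at_uniq/IHy/ltnW.
apply: can_in_inj (unfill y.+1) _ => _ /allpairsP[[[u v] [a b]] [+ _ ->]].
move=> /flatten_mapP[w]; rewrite mem_gapwords ?(ltnW lt_y) // mem_splits_at.
move=> + /eqP w_eq; rewrite w_eq => gap_uv.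
have [all_u _] := gapword_cat_all gap_uv.
have [u_gap v_gap _ _] := gapword_cat_ends gap_uv.
apply: fillK; rewrite ?(ltn_eqF lt_y) //.
by apply/negP => /(allP all_u); rewrite /letter_or_gap; lia.
Qed.

Lemma gaps_fill y u v a b :
  y.+1 < gap ->
  (gaps (fill y.+1 (u, v) (a, b))).+1 = gaps (u ++ gap :: v) + a + b.
Proof.
move=> lt_y; rewrite /gaps /fill !count_cat /= count_cat !count_nseq /= eqxx.
by rewrite (ltn_eqF lt_y); lia.
Qed.

Lemma subword_fill y u v a b k : k <= y -> y.+1 < gap ->
  subword (fill y.+1 (u, v) (a, b)) k = subword (u ++ gap :: v) k.
Proof.
move=> le_k lt_y; rewrite /subword /fill /= !filter_cat /= filter_cat !filter_nseq.
have -> : (0 < gap <= k) = false by lia.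
by have -> : (y < k) = false by lia.
Qed.

Lemma descents_across_gaps y x w :
  y.+1 < gap -> all (letter_or_gap y) w -> sorted not_both_gaps (x :: w) ->
  (x <= y) || (x == gap) ->
  descents_across y.+1 x w + (last x w == gap) = gaps (x :: w).
Proof.
move=> lt_y; elim: w x => [|d w IHw] x /=; first by rewrite addn0.
case/andP=> d_small all_w /andP[xd_gap sorted_w] x_small.
have /(_ sorted_w) /= := IHw d all_w.
rewrite [descents_across _ x _]/descents_across /= -/(descents_across _ _ _).
by move: d_small xd_gap x_small; rewrite /letter_or_gap /not_both_gaps; lia.
Qed.

Lemma les_cat_gap b w : all (leq^~ gap) w -> les (w ++ nseq b gap) = les w.
Proof.
move=> w_le; case: b; last by rewrite cats0.
by rewrite cats1 les_rcons descents_across_ge ?addn0.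
Qed.

Section FillStatistics.

Variables (y : nat) (u v : seq nat).
Hypothesis lt_y : y.+1 < gap.
Hypothesis gap_uv : gapword y (u ++ gap :: v).

Lemma slope_stat_fill F a b :
  F false false = false ->
  slope_stat F (fill y.+1 (u, v) (a, b)) = slope_stat F (u ++ gap :: v) + F a b.
Proof.
have [_ _ le_u le_v] := gapword_cat_ends gap_uv.
move=> F0; rewrite /slope_stat /fill /= !slope_count_cat /=.
rewrite [slope_count F 0 u _](@eq_slope_count_end _ _ _ _ gap); last first.
  by case: (a) => /=; lia.
rewrite -!addnA; congr addn.
have start_v : slope_count F gap v 0 = slope_count F y.+1 v 0.
  by apply: eq_slope_count_start; lia.
have gap_u : (gap < last 0 u) = false by lia.
have gap_v : (gap < head 0 v) = false by lia.
have y_u : (y.+1 < last 0 u) = false by lia.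
have y_v : (y.+1 < head 0 v) = false by lia.
have gap_y : (gap < y.+1) = false by lia.
case: a b => [] [] /=; rewrite ?(gap_u, gap_v, y_u, y_v, gap_y, lt_y, F0, start_v).
all: by rewrite ?add0n ?addn0 // addnC.
Qed.

Lemma valleys_fill a b :
  valleys (fill y.+1 (u, v) (a, b)) = valleys (u ++ gap :: v) + (a && b).
Proof. by rewrite !valleysE slope_stat_fill. Qed.

Lemma double_descents_fill a b :
  double_descents (fill y.+1 (u, v) (a, b)) =
  double_descents (u ++ gap :: v) + (a && ~~ b).
Proof. by rewrite /double_descents slope_stat_fill. Qed.

Lemma double_ascents_fill a b :
  double_ascents (fill y.+1 (u, v) (a, b)) =
  double_ascents (u ++ gap :: v) + (~~ a && b).
Proof. by rewrite /double_ascents slope_stat_fill. Qed.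

Lemma descents_across_left_gaps a :
  descents_across y.+1 0 (u ++ nseq a gap) = gaps u.
Proof.
have [u_gap _ _ _] := gapword_cat_ends gap_uv.
have [all_u _] := gapword_cat_all gap_uv.
have gap_gt0 := gapword_gap_gt0 gap_uv.
have sorted_u : sorted not_both_gaps (0 :: u).
  have := gap_uv; rewrite gapword_catE => /and5P[_ _ ? _ _].
  by rewrite -cat1s sorted_not_both_gaps_cat // /not_both_gaps /= ltn_eqF // andbT.
have := descents_across_gaps lt_y all_u sorted_u isT.
rewrite (negbTE u_gap) addn0 /= (ltn_eqF gap_gt0) add0n => <-.
rewrite descents_across_cat; case: a; rewrite /descents_across /= ?addn0 //.
by rewrite [gap < _]ltnNge ltnW // addn0.
Qed.

Lemma les_fill a b :
  les (fill y.+1 (u, v) (a, b)) = les (u ++ gap :: v) + gaps u.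
Proof.
have [_ _ le_u _] := gapword_cat_ends gap_uv.
have [all_u all_v] := gapword_cat_all gap_uv.
have u_le_gap : all (leq^~ gap) u.
  by apply: sub_all all_u => c; rewrite /letter_or_gap; lia.
have les_u_gap : les (u ++ [:: gap]) = les u by rewrite (les_cat_gap true).
have les_u_fill : les (u ++ nseq a gap ++ y.+1 :: nseq b gap) = les u + gaps u.
  rewrite -cat_rcons !catA les_cat_gap; last first.
    by rewrite !all_cat all_rcons u_le_gap all_nseq leqnn (ltnW lt_y) orbT.
  by rewrite -rcons_cat les_rcons descents_across_left_gaps les_cat_gap.
have -> : fill y.+1 (u, v) (a, b) = (u ++ nseq a gap ++ y.+1 :: nseq b gap) ++ v.
  by rewrite /fill /= -!catA.
have -> : u ++ gap :: v = (u ++ [:: gap]) ++ v by rewrite -catA.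
suff /les_cat_congr : {in v, forall c w,
    descents_across c 0 ((u ++ nseq a gap ++ y.+1 :: nseq b gap) ++ w) =
    descents_across c 0 ((u ++ [:: gap]) ++ w)}.
  by rewrite les_u_gap les_u_fill; lia.
move=> c /(allP all_v) c_small w; rewrite -!catA !(descents_across_cat _ _ u).
congr addn; move: c_small; rewrite /letter_or_gap /descents_across.
by case: w a b {les_u_fill} => [|d w] [] [] /=; lia.
Qed.

End FillStatistics.

Lemma res_fill y u v a b :
  y.+1 < gap -> gapword y (u ++ gap :: v) ->
  res (fill y.+1 (u, v) (a, b)) = res (u ++ gap :: v) + gaps v.
Proof.
move=> lt_y; have rev_uv : rev (u ++ gap :: v) = rev v ++ gap :: rev u.
  by rewrite rev_cat rev_cons cat_rcons.
have rev_fill : rev (fill y.+1 (u, v) (a, b)) = fill y.+1 (rev v, rev u) (b, a).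
  by rewrite /fill !rev_cat rev_cons rev_cat !rev_nseq -!cats1 -!catA.
rewrite -gapword_rev rev_uv => gap_vu.
by rewrite !res_rev rev_fill rev_uv les_fill // /gaps count_rev.
Qed.

Lemma stats_gap :
  [/\ res [:: gap] = 0, les [:: gap] = 0, valleys [:: gap] = 0,
      double_descents [:: gap] = 0 & double_ascents [:: gap] = 0].
Proof. by rewrite /res /les valleysE !big_geq. Qed.

Lemma gapword_size y w :
  gapword y w ->
  y + gaps w = (valleys w).*2.+1 + double_ascents w + double_descents w.
Proof.
move: y w; apply: gapword_ind => [|y u v a b lt_y gap_uv IHuv].
  by have [_ _ -> -> ->] := stats_gap; rewrite /gaps /= eqxx.
have := gaps_fill u v a b lt_y.
rewrite valleys_fill // double_ascents_fill // double_descents_fill //.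
by case: (a) (b) => [] [] /=; lia.
Qed.

(** * Locked gaps *)

(* The gap in front of [v] is locked when it is the left slot of the letter
   heading [v] while the right slot of that letter is still empty. *)
Definition locked v : bool :=
  if v is c :: d :: v' then (d == gap) && (head 0 v' <= c) else false.

Definition locks w : nat := count (fun uv => locked uv.2) (splits_at gap w).

(* The only gap of [u ++ v] inside [u] whose lock may depend on [v]. *)
Definition boundary_lock u v : bool :=
  [&& 1 < size u, nth 0 u (size u).-2 == gap & locked (last 0 u :: v)].

Definition unlocks u v : bool := boundary_lock u (gap :: v).

Lemma lockedP v :
  reflect (exists c v', v = [:: c, gap & v'] /\ head 0 v' <= c) (locked v).
Proof.
apply: (iffP idP) => [|[c [v' [-> le_c]]]]; last by rewrite /= eqxx.
by case: v => [|c [|d v']] //= /andP[/eqP-> le_c]; exists c, v'.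
Qed.

Lemma unlocksP u v :
  reflect (exists u' c, u = u' ++ [:: gap; c] /\ head 0 v <= c) (unlocks u v).
Proof.
apply: (iffP and3P) => [[]|[u' [c [-> le_c]]]].
  case/lastP: u => // u c; case/lastP: u => // u d _.
  rewrite !size_rcons /= !nth_rcons size_rcons ltnSn ltnn eqxx last_rcons => /eqP->.
  by rewrite eqxx => le_c; exists u, c; rewrite -!cats1 -catA.
by rewrite size_cat addn2 /= nth_cat ltnn subnn /= last_cat /= !eqxx.
Qed.

Lemma unlocks_le_gaps u v : unlocks u v <= gaps u.
Proof.
case: unlocksP => // -[u' [c [-> _]]].
by rewrite /gaps count_cat /= eqxx; lia.
Qed.

Lemma perm_splits_unlocks w :
  perm_eq [seq uv <- splits_at gap w | unlocks uv.1 uv.2]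
    [seq (uv.1 ++ gap :: take 1 uv.2, drop 2 uv.2) |
       uv <- splits_at gap w & locked uv.2].
Proof.
apply: uniq_perm; first exact/filter_uniq/splits_at_uniq.
  rewrite map_inj_in_uniq; first exact/filter_uniq/splits_at_uniq.
  move=> [u v] [u' v']; rewrite !mem_filter /= => /andP[/lockedP[c [v1 [-> _]]] _].
  move=> /andP[/lockedP[c' [v1' [-> _]]] _] /=; rewrite !drop0 -!cat_rcons !cats0.
  by case=> /rcons_inj[/rcons_inj[->] ->] ->.
move=> [u v]; rewrite mem_filter mem_splits_at; apply/andP/mapP.
  case=> /unlocksP[u' [c [/= -> le_c]]] /eqP->.
  exists (u', [:: c, gap & v]); last by rewrite /= drop0.
  by rewrite mem_filter mem_splits_at -catA /= !eqxx le_c.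
case=> [[u' v']] + [-> ->]; rewrite mem_filter mem_splits_at /=.
move=> /andP[/lockedP[c [v1 [-> le_c]]] /eqP->] /=.
by rewrite drop0 -catA; split=> //; apply/unlocksP; exists u', c.
Qed.

Lemma locks_cons c w : locks (c :: w) = ((c == gap) && locked w) + locks w.
Proof.
by rewrite /locks /= count_cat count_map; case: eqP => //= _; rewrite addn0.
Qed.

Lemma locks_full w : gap \notin w -> locks w = 0.
Proof.
elim: w => //= c w IHw; rewrite inE negb_or eq_sym => /andP[/negbTE c_gap /IHw].
by rewrite locks_cons c_gap.
Qed.

Lemma locks_cat u w :
  last 0 u != gap -> locks (u ++ w) = locks u + boundary_lock u w + locks w.
Proof.
elim: u => [|c [|d u] IHu] //= u_gap; first by rewrite !locks_cons (negbTE u_gap).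
rewrite !(locks_cons c) -cat_cons IHu //.
case: u u_gap {IHu} => [|e u] /= u_gap.
  by rewrite /boundary_lock /= andbF; lia.
rewrite -[boundary_lock [:: c, d, e & u] w]/(boundary_lock [:: d, e & u] w) !addnA.
by case: u u_gap => //= /negbTE->.
Qed.

Lemma locks_fill y u v a b :
  y.+1 < gap -> gapword y (u ++ gap :: v) -> ~~ locked v ->
  locks (fill y.+1 (u, v) (a, b)) + unlocks u v = locks (u ++ gap :: v) + (a && b).
Proof.
move=> lt_y gap_uv not_locked.
have [u_gap v_gap le_u le_v] := gapword_cat_ends gap_uv.
rewrite /fill /= !(locks_cat _ u_gap) (locks_cons gap v) (negbTE not_locked) andbF.
have -> : boundary_lock u (nseq a gap ++ y.+1 :: nseq b gap ++ v) = false.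
  rewrite /boundary_lock; case: (a); rewrite /= ?(ltn_eqF lt_y) ?andbF //.
  by rewrite eqxx [_ <= last _ _]leqNgt ltnS le_u !andbF.
have locked_fill : locked (y.+1 :: nseq b gap ++ v) = b.
  case: (b) => /=; first by rewrite eqxx leqW.
  by case: (v) v_gap => //= c v' /negbTE->.
have -> : locks (nseq a gap ++ y.+1 :: nseq b gap ++ v) = locks v + (a && b).
  have -> w : locks (nseq a gap ++ w) = a && locked w + locks w.
    by case: (a); rewrite /= ?locks_cons ?eqxx.
  rewrite locked_fill locks_cons (ltn_eqF lt_y) add0n.
  by case: (b); rewrite /= ?locks_cons ?(negbTE not_locked) ?andbF addnC.
by rewrite /unlocks; lia.
Qed.

Lemma starts_with_descent_ungap y u v :
  gapword y (u ++ gap :: v) -> double_descents (u ++ gap :: v) = 0 ->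
  starts_with_descent (ungap v) = locked v.
Proof.
case: v => [|c v] // gap_uv; have [_ /= c_gap _ le_c] := gapword_cat_ends gap_uv.
have lt_c : c < gap := leq_ltn_trans le_c (gapword_lt_gap gap_uv).
move=> /ascent_after_descent/(_ lt_c); rewrite c_gap.
case: v gap_uv => //= d v gap_uv lt_d.
case: (eqVneq d gap) gap_uv => [->|_] gap_uv /=; last by rewrite leqNgt lt_d.
have := gap_uv; rewrite -[[:: gap, c, gap & v]]/([:: gap; c] ++ gap :: v) catA.
by move=> /gapword_cat_ends[_ v_gap _ _]; rewrite head_ungap.
Qed.

Lemma unlocks_not_locked y u v :
  gapword y (u ++ gap :: v) -> andre y (u ++ gap :: v) ->
  unlocks u v -> ~~ locked v.
Proof.
move=> gap_uv andre_uv /unlocksP[u' [c [u_eq le_c]]].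
have /andP[/eqP no_dd _] := andre_uv.
rewrite -(starts_with_descent_ungap gap_uv no_dd).
have := andre_ungap gap_uv andre_uv; have [] := gapword_cat_ends gap_uv.
have /and4P[_ _ /perm_uniq + _] := gap_uv.
rewrite iota_uniq u_eq /ungap !filter_cat /= eqxx last_cat /= => + c_gap d_gap _ _.
rewrite c_gap /=; case: v d_gap le_c {gap_uv andre_uv no_dd} => //= d v -> /= le_c.
rewrite -catA cat_uniq => /and3P[_ _ /= /andP[c_v _]] /ascent_after_descent.
rewrite -ltnNge; apply; rewrite ltn_neqAle le_c andbT.
by apply: contraNneq c_v => ->; rewrite mem_head.
Qed.

Lemma andre_gap : andre 0 [:: gap].
Proof. by rewrite /andre /subword /= [gap <= 0]leqn0 lt0n andNb. Qed.

Lemma andre_fill y u v a b :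
  y.+1 < gap -> gapword y (u ++ gap :: v) ->
  andre y.+1 (fill y.+1 (u, v) (a, b)) =
  [&& andre y (u ++ gap :: v), ~~ locked v & a ==> b].
Proof.
move=> lt_y gap_uv; rewrite {1}/andre double_descents_fill // addn_eq0.
rewrite [iota 0 y.+2]iota_rcons all_rcons add0n.
have [u_gap v_gap le_u le_v] := gapword_cat_ends gap_uv.
have gap_fill : gapword y.+1 (fill y.+1 (u, v) (a, b)) by rewrite gapword_fill.
rewrite (subword_ungap (gapword_all gap_fill)) ?leqnn // ungap_fill; last first.
  by rewrite ltn_eqF.
have -> : all (fun k => double_descents (subword (fill y.+1 (u, v) (a, b)) k) == 0)
    (iota 0 y.+1) =
    all (fun k => double_descents (subword (u ++ gap :: v) k) == 0) (iota 0 y.+1).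
  by apply: eq_in_all => k; rewrite mem_iota ltnS => le_k; rewrite subword_fill.
case: (boolP (andre y (u ++ gap :: v))) => [andre_uv|]; last first.
  by case/nandP => /negbTE->; rewrite ?andbF.
have /andP[/eqP no_dd ->] := andre_uv; rewrite no_dd.
rewrite double_descents_insert_max ?head_ungap ?last_ungap //.
  rewrite (starts_with_descent_ungap gap_uv) //.
  by rewrite andbT andbC eqb0; case: (a) (b) => [] [].
by rewrite -(andre_ungap gap_uv andre_uv) /ungap !filter_cat /= eqxx.
Qed.

Lemma andre_valleys_bounds y w :
  gapword y w -> andre y w -> locks w <= valleys w <= les w + locks w.
Proof.
move: y w; apply: gapword_ind => [|y u v a b lt_y gap_uv IHuv].
  by have [_ -> -> _ _] := stats_gap; rewrite /locks /= eqxx.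
rewrite andre_fill // => /and3P[/IHuv {}IHuv not_locked _].
have := locks_fill a b lt_y gap_uv not_locked; have := unlocks_le_gaps u v.
by rewrite valleys_fill // les_fill //; lia.
Qed.

(* The number of valleys whose left gap is no longer locked; the subtraction
   does not truncate on Andre words, by [andre_valleys_bounds]. *)
Definition unlocked_valleys w : nat := valleys w - locks w.

Lemma unlocked_valleys_fill y u v a b :
  y.+1 < gap -> gapword y (u ++ gap :: v) -> andre y (u ++ gap :: v) ->
  ~~ locked v ->
  unlocked_valleys (fill y.+1 (u, v) (a, b)) =
  unlocked_valleys (u ++ gap :: v) + unlocks u v.
Proof.
move=> lt_y gap_uv andre_uv not_locked.
have := andre_valleys_bounds gap_uv andre_uv.
have := locks_fill a b lt_y gap_uv not_locked.
by rewrite /unlocked_valleys valleys_fill //; lia.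
Qed.

(** * Weighted Motzkin paths *)

Local Open Scope ring_scope.

Section Weights.

Variables (R : comNzRingType) (p q : R).
Implicit Types x d e : R.

Fixpoint pq_int (m : nat) : R := if m is m'.+1 then p ^+ m' + q * pq_int m' else 0.

Fixpoint motzkin x e (k m : nat) : R :=
  if k is k'.+1 then
    pq_int m
    * (x * motzkin x e k' m.+1 + e * motzkin x e k' m + motzkin x e k' m.-1)
  else (m == 0%N)%:R.

Definition slope_weight x d e a b : R :=
  x ^+ (a && b) * d ^+ (a && ~~ b) * e ^+ (~~ a && b).

Lemma sum_splits_pq_int w :
  \sum_(uv <- splits_at gap w) q ^+ gaps uv.1 * p ^+ gaps uv.2 = pq_int (gaps w).
Proof.
elim: w => [|c w IHw]; first by rewrite big_nil.
rewrite /= big_cat big_map /=; case: eqP => _ /=.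
  rewrite big_seq1 expr0 mul1r -IHw mulr_sumr; congr (_ + _).
  by apply: eq_bigr => uv _; rewrite exprS mulrA.
by rewrite big_nil add0r -IHw.
Qed.

Lemma sum_splits_unlocks y w (F : nat -> nat -> R) :
  gapword y w ->
  \sum_(uv <- splits_at gap w | unlocks uv.1 uv.2) F (gaps uv.1).-1 (gaps uv.2).+1 =
  \sum_(uv <- splits_at gap w | locked uv.2) F (gaps uv.1) (gaps uv.2).
Proof.
move=> gap_w; rewrite -big_filter (perm_big _ (perm_splits_unlocks w)).
rewrite big_map big_filter big_seq_cond [RHS]big_seq_cond.
apply: eq_bigr => -[u v] /andP[]; rewrite mem_splits_at => /eqP w_eq.
move=> /lockedP[c [v' [/= v_eq _]]].
rewrite w_eq v_eq in gap_w.
have [_ /= /negbTE c_gap _ _] := gapword_cat_ends gap_w.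
by rewrite v_eq /= drop0 /gaps count_cat /= eqxx c_gap addn1 !add0n add1n.
Qed.

(* An unlocking gap takes over the weight of the gap that it unlocks, which is
   obtained from its own by trading a factor q for p. *)
Lemma sum_splits_andre y w :
  gapword y w -> andre y w ->
  \sum_(uv <- splits_at gap w | ~~ locked uv.2)
     q ^+ (gaps uv.1 - unlocks uv.1 uv.2) * (p + q) ^+ unlocks uv.1 uv.2
     * p ^+ gaps uv.2 =
  pq_int (gaps w).
Proof.
move=> gap_w andre_w; rewrite -sum_splits_pq_int.
rewrite [RHS](bigID (fun uv => locked uv.2)) /=.
rewrite -(@sum_splits_unlocks y w (fun i j => q ^+ i * p ^+ j)) //.
have unlocks_not_locked_in uv :
    (uv \in splits_at gap w) && unlocks uv.1 uv.2 =
    [&& uv \in splits_at gap w, ~~ locked uv.2 & unlocks uv.1 uv.2].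
  case: uv => u v; rewrite mem_splits_at; case: eqP => //= w_eq.
  rewrite w_eq in gap_w andre_w; rewrite andb_idl //.
  exact: unlocks_not_locked gap_w andre_w.
rewrite [X in _ = X + _]big_seq_cond (eq_bigl _ _ unlocks_not_locked_in).
rewrite -big_seq_cond big_mkcondr -big_split; apply: eq_bigr => -[u v] _ /=.
have := unlocks_le_gaps u v; case: (unlocks u v) => [|_]; last first.
  by rewrite add0r subn0 expr0 mulr1.
by case: (gaps u) => // m _; rewrite subn1 /= !exprS; ring.
Qed.

Section Recurrence.

Variables (x d e : R).
Variables (W : nat -> seq nat -> R) (g : seq nat -> seq nat -> R).

Hypothesis W_fill : forall y u v a b,
  (y.+1 < gap)%N -> gapword y (u ++ gap :: v) ->
  W y.+1 (fill y.+1 (u, v) (a, b)) =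
  W y (u ++ gap :: v) * g u v * slope_weight x d e a b.

Hypothesis W_sum_g : forall y w,
  (y.+1 < gap)%N -> gapword y w ->
  W y w * (\sum_(uv <- splits_at gap w) g uv.1 uv.2) = W y w * pq_int (gaps w).

Lemma sum_gapwordsS y k :
  (y.+1 < gap)%N ->
  \sum_(w <- gapwords y.+1) W y.+1 w * motzkin x (d + e) k (gaps w) =
  \sum_(w <- gapwords y) W y w * motzkin x (d + e) k.+1 (gaps w).
Proof.
move=> lt_y; rewrite big_allpairs_dep big_flatten big_map /=.
rewrite big_seq [RHS]big_seq; apply: eq_bigr => w.
rewrite mem_gapwords ?(ltnW lt_y) // => gap_w.
rewrite /= mulrA -W_sum_g // -mulrA mulr_suml mulr_sumr.
rewrite big_seq [RHS]big_seq; apply: eq_bigr => -[u v].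
rewrite mem_splits_at => /eqP w_eq; rewrite w_eq in gap_w *.
rewrite !big_cons big_nil /=.
have gapsE a b : gaps (fill y.+1 (u, v) (a, b)) = (gaps (u ++ gap :: v) + a + b).-1.
  by rewrite -(gaps_fill _ _ _ _ lt_y).
by rewrite !W_fill // !gapsE !addn0 !addn1 /slope_weight /=; ring.
Qed.

Lemma sum_full_gapwords n :
  (n < gap)%N ->
  \sum_(w <- gapwords n | gap \notin w) W n w =
  W 0%N [:: gap] * motzkin x (d + e) n 1.
Proof.
move=> lt_n.
have sum_gapwordsB k : (k <= n)%N ->
    \sum_(w <- gapwords n) W n w * motzkin x (d + e) 0 (gaps w) =
    \sum_(w <- gapwords (n - k)) W (n - k)%N w * motzkin x (d + e) k (gaps w).
  elim: k => [|k IHk] lt_k; first by rewrite subn0.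
  by rewrite IHk ?(ltnW lt_k) // -subnSK // sum_gapwordsS // subnSK //; lia.
have := sum_gapwordsB n (leqnn n); rewrite subnn big_seq1 /= eqxx addn0 => <-.
rewrite big_mkcond; apply: eq_bigr => w _.
by rewrite -has_pred1 has_count -eqn0Ngt; case: (_ == _); rewrite ?mulr1 ?mulr0.
Qed.

End Recurrence.

Definition pq_weight x d e w : R :=
  p ^+ res w * q ^+ les w
  * (x ^+ valleys w * d ^+ double_descents w * e ^+ double_ascents w).

(* A valley trades a factor [q] for [p + q] when its left gap is unlocked. *)
Definition andre_weight x e y w : R :=
  if andre y w then
    p ^+ res w * q ^+ (les w - unlocked_valleys w) * (p + q) ^+ unlocked_valleys w
    * (x ^+ valleys w * e ^+ double_ascents w)
  else 0.

Lemma sum_pq_weight x d e n :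
  (n < gap)%N ->
  \sum_(w <- gapwords n | gap \notin w) pq_weight x d e w = motzkin x (d + e) n 1.
Proof.
move=> lt_n; rewrite (@sum_full_gapwords x d e (fun=> pq_weight x d e)
  (fun u v => q ^+ gaps u * p ^+ gaps v)) //.
- by rewrite /pq_weight; have [-> -> -> -> ->] := stats_gap; rewrite !mulr1 mul1r.
- move=> y u v a b lt_y gap_uv.
  rewrite /pq_weight res_fill // les_fill // valleys_fill //.
  by rewrite double_descents_fill // double_ascents_fill // !exprD /slope_weight; ring.
by move=> y w _ _; rewrite sum_splits_pq_int.
Qed.

Lemma andre_weight_fill x e y u v a b :
  (y.+1 < gap)%N -> gapword y (u ++ gap :: v) ->
  andre_weight x e y.+1 (fill y.+1 (u, v) (a, b)) =
  andre_weight x e y (u ++ gap :: v)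
  * (if locked v then 0
     else q ^+ (gaps u - unlocks u v) * (p + q) ^+ unlocks u v * p ^+ gaps v)
  * slope_weight x 0 e a b.
Proof.
move=> lt_y gap_uv; rewrite /andre_weight andre_fill // res_fill // les_fill //.
rewrite valleys_fill // double_ascents_fill //.
case: (boolP (andre _ _)) => [andre_uv|_]; last by rewrite !mul0r.
case: (boolP (locked v)) => [_|not_locked]; first by rewrite mulr0 mul0r.
rewrite unlocked_valleys_fill //; set w := u ++ gap :: v.
have -> : (les w + gaps u - (unlocked_valleys w + unlocks u v) =
    les w - unlocked_valleys w + (gaps u - unlocks u v))%N.
  have := andre_valleys_bounds gap_uv andre_uv; have := unlocks_le_gaps u v.
  by rewrite /unlocked_valleys /w; lia.
by rewrite /= !exprD /slope_weight; case: a b => [] [] /=; ring.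
Qed.

Lemma sum_andre_weight x e n :
  (n < gap)%N ->
  \sum_(w <- gapwords n | gap \notin w) andre_weight x e n w = motzkin x e n 1.
Proof.
move=> lt_n; rewrite (sum_full_gapwords (@andre_weight_fill x e)) //.
  rewrite add0r /andre_weight andre_gap /unlocked_valleys.
  by have [-> -> -> _ ->] := stats_gap; rewrite sub0n !mulr1 mul1r.
move=> y w _ gap_w; rewrite /andre_weight; case: ifP => [andre_w|_]; last first.
  by rewrite !mul0r.
rewrite -(sum_splits_andre gap_w andre_w) [in RHS]big_mkcond /=; congr (_ * _).
by apply: eq_bigr => uv _; rewrite if_neg.
Qed.

End Weights.

End GapWords.

(** * Permutations *)

Lemma perm_word n (s : 'S_n) : perm_eq (word s) (iota 1 n).
Proof.
have -> : iota 1 n = [seq i.+1 | i <- [seq val i | i <- enum 'I_n]].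
  by rewrite val_enum_ord -[1%N]addn0 iotaDl.
rewrite /word -map_comp (map_comp (fun i : 'I_n => i.+1) s).
apply/perm_map/uniq_perm; last 2 first.
- exact: enum_uniq.
- move=> i; rewrite mem_enum; apply/mapP.
  by exists ((s^-1)%g i); rewrite ?permKV ?mem_enum.
by rewrite (map_inj_uniq perm_inj) enum_uniq.
Qed.

Lemma word_inj n : injective (@word n).
Proof.
move=> s s' /eq_in_map eq_ss'; apply/permP => i; apply/val_inj/succn_inj/eq_ss'.
exact: mem_enum.
Qed.

Lemma perm_words n : perm_eq [seq word s | s : 'S_n] (permutations (iota 1 n)).
Proof.
have uniq_words : uniq [seq word s | s : 'S_n].
  by rewrite (map_inj_uniq (@word_inj n)) enum_uniq.
have words_perm : {subset [seq word s | s : 'S_n] <= permutations (iota 1 n)}.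
  by move=> _ /mapP[s _ ->]; rewrite mem_permutations perm_word.
have size_words : size (permutations (iota 1 n)) <= size [seq word s | s : 'S_n].
  by rewrite size_permutations ?iota_uniq // size_iota size_map -cardE card_Sn.
have [_ eq_words] := uniq_min_size uniq_words words_perm size_words.
exact: uniq_perm uniq_words (permutations_uniq _) eq_words.
Qed.

Lemma perm_iota_uniq0 n w : perm_eq w (iota 1 n) -> uniq (0 :: w).
Proof.
move=> perm_w; rewrite /= (perm_mem perm_w) mem_iota.
by rewrite (perm_uniq perm_w) iota_uniq.
Qed.

Lemma gapword_full n w :
  0 < n -> gapword n.+1 n w && (n.+1 \notin w) = perm_eq w (iota 1 n).
Proof.
move=> n_gt0; apply/andP/idP => [[/and4P[_ _ + _] no_gap]|perm_w].
  by rewrite /ungap (all_filterP _) //; apply/allP => c; apply: contraTneq => ->.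
have no_gap : n.+1 \notin w by rewrite (perm_mem perm_w) mem_iota; lia.
have all_letters : all (predC1 n.+1) w by apply/allP => c; apply: contraTneq => ->.
split=> //; apply/and4P; split=> //.
- apply: contraTneq n_gt0 => w_eq.
  by move/perm_size: perm_w; rewrite w_eq size_iota => <-.
- by rewrite /ungap (all_filterP all_letters).
case: w all_letters {perm_w no_gap} => //= c w /andP[c_gap].
elim: w c c_gap => //= d w IHw c c_gap /andP[d_gap /(IHw _ d_gap)->].
by rewrite /not_both_gaps c_gap.
Qed.

Lemma big_word (R : Type) (idx : R) (op : Monoid.com_law idx) n (f : seq nat -> R) :
  0 < n ->
  \big[op/idx]_(s : 'S_n) f (word s) =
  \big[op/idx]_(w <- gapwords n.+1 n | n.+1 \notin w) f w.
Proof.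
move=> n_gt0; rewrite -[RHS]big_filter -big_enum -(big_map (@word n) xpredT f) /=.
apply: perm_big; apply: perm_trans (perm_words n) _; apply: uniq_perm.
- exact: permutations_uniq.
- exact/filter_uniq/gapwords_uniq.
by move=> w; rewrite mem_permutations mem_filter mem_gapwords // andbC gapword_full.
Qed.

Lemma double_ascents_word n (s : 'S_n) :
  0 < n -> double_descents (word s) = 0 ->
  double_ascents (word s) = n - 1 - 2 * valleys (word s) /\
  valleys (word s) < ((n - 1) %/ 2).+1.
Proof.
move=> n_gt0 no_dd.
have := perm_word s; rewrite -gapword_full // => /andP[gap_w no_gap].
have := gapword_size gap_w; rewrite no_dd.
have -> : gaps n.+1 (word s) = 0 by apply/count_memPn.
by move=> n_eq; split; lia.
Qed.

Lemma is_andreE n w : perm_eq w (iota 1 n) -> is_andre w = andre n w.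
Proof.
move=> perm_w; have size_w : size w = n by rewrite (perm_size perm_w) size_iota.
have subword_n : subword w n = w.
  by apply/all_filterP/allP => c; rewrite (perm_mem perm_w) mem_iota add1n ltnS.
have subword_0 : subword w 0 = [::].
  by rewrite -(filter_pred0 w); apply: eq_filter => -[].
have no_dd_subword k : 0 < k <= n ->
    no_double_descent (subword w k) && ends_with_ascent (subword w k) =
    (double_descents (subword w k) == 0).
  move=> k_bounds; have uniq_0k : uniq (0 :: subword w k).
    have /andP[_ uniq_w] := perm_iota_uniq0 perm_w.
    by rewrite /= mem_filter filter_uniq.
  have k_gt0 : 0 < size (subword w k).
    rewrite size_filter -has_count; apply/hasP; exists 1; last by lia.
    by rewrite (perm_mem perm_w) mem_iota; lia.
  rewrite -no_double_descentE // andb_idr //.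
  exact: no_double_descent_ends_with_ascent.
rewrite /is_andre size_w /andre /= subword_0 /=.
rewrite (@eq_in_all _ _ (fun k => double_descents (subword w k) == 0)); last first.
  by move=> k; rewrite mem_iota => k_bounds; rewrite no_dd_subword //; lia.
rewrite andb_idl // => /allP/(_ n); rewrite subword_n.
case: (posnP n) => [n0 _|n_gt0]; first by rewrite (size0nil (etrans size_w n0)).
by apply; rewrite mem_iota n_gt0 add1n ltnS leqnn.
Qed.

Local Open Scope ring_scope.

Section Expansions.

Variables (R : comNzRingType) (p q : R) (n : nat).
Hypothesis n_gt0 : (0 < n)%N.

Lemma Apoly_motzkin (t : R) : Apoly n p q t = motzkin p q t (1 + t) n 1.
Proof.
rewrite addrC -(@sum_pq_weight n.+1) // -big_word //.
by apply: eq_bigr => s _; rewrite /pq_weight expr1n mulr1 -exprD desE.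
Qed.

Lemma sum_gamma_motzkin (x e : R) :
  \sum_(0 <= k < ((n - 1) %/ 2).+1) gamma n k p q * x ^+ k * e ^+ (n - 1 - 2 * k) =
  motzkin p q x e n 1.
Proof.
rewrite -[e in RHS]add0r -(@sum_pq_weight n.+1) // -big_word //.
transitivity (\sum_(0 <= k < ((n - 1) %/ 2).+1)
  \sum_(s : 'S_n | (double_descents (word s) == 0%N) && (valleys (word s) == k))
    p ^+ res (word s) * q ^+ les (word s) * x ^+ k * e ^+ (n - 1 - 2 * k)).
  apply: eq_bigr => k _; rewrite /gamma !mulr_suml; apply: eq_bigl => s.
  by rewrite inE no_double_descentE ?(perm_iota_uniq0 (perm_word s)) // andbC.
rewrite big_nat_fibers => [|s /eqP/(double_ascents_word n_gt0)[] //].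
rewrite big_mkcond; apply: eq_bigr => s _; rewrite /pq_weight.
case: eqP => [no_dd|/eqP some_dd]; last first.
  by rewrite expr0n (negbTE some_dd) mulr0 mul0r mulr0.
have [-> _] := double_ascents_word n_gt0 no_dd.
by rewrite no_dd expr0 mulr1 mulrA.
Qed.

Lemma sum_dpoly_motzkin (x e : R) :
  \sum_(0 <= k < ((n - 1) %/ 2).+1)
     (p + q) ^+ k * dpoly n k p q * x ^+ k * e ^+ (n - 1 - 2 * k) =
  motzkin p q x e n 1.
Proof.
rewrite -(@sum_andre_weight n.+1) // -big_word //.
transitivity (\sum_(0 <= k < ((n - 1) %/ 2).+1)
  \sum_(s : 'S_n | andre n (word s) && (valleys (word s) == k))
    (p + q) ^+ k * (p ^+ res (word s) * q ^+ (les (word s) - k))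
    * x ^+ k * e ^+ (n - 1 - 2 * k)).
  apply: eq_bigr => k _; rewrite /dpoly mulr_sumr !mulr_suml; apply: eq_bigl => s.
  rewrite inE (is_andreE (perm_word s)) desE.
  by case: (boolP (andre _ _)) => //= /andP[/eqP-> _]; rewrite addn0.
rewrite big_nat_fibers => [|s /andP[/eqP/(double_ascents_word n_gt0)[] //]].
rewrite big_mkcond; apply: eq_bigr => s _; rewrite /andre_weight.
case: ifP => // /andP[/eqP/(double_ascents_word n_gt0)[-> _] _].
rewrite /unlocked_valleys locks_full ?subn0; first by ring.
by rewrite (perm_mem (perm_word s)) mem_iota; lia.
Qed.

End Expansions.

Theorem theorem1p5 (R : comNzRingType) (n : nat) (hn : (1 <= n)%N) (p q t : R) :
  Apoly n p q t =
    \sum_(0 <= k < ((n - 1) %/ 2).+1)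
      gamma n k p q * t ^+ k * (1 + t) ^+ (n - 1 - 2 * k)
  /\
  \sum_(0 <= k < ((n - 1) %/ 2).+1)
      gamma n k p q * t ^+ k * (1 + t) ^+ (n - 1 - 2 * k) =
    \sum_(0 <= k < ((n - 1) %/ 2).+1)
      (p + q) ^+ k * dpoly n k p q * t ^+ k * (1 + t) ^+ (n - 1 - 2 * k).
Proof.
by rewrite Apoly_motzkin // sum_gamma_motzkin // sum_dpoly_motzkin.
Qed.
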